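(* Let $n\ge2$ be finite. Let $A(Q)$ be a trivially analytic subalgebra of $A(P_{UHF})$ with cocycle $d$; that is, $d$ is a (not identically zero) trivial cocycle on $P_{UHF}$ such that $Q=\{(x,0,y)\in P_{UHF}\mid d(x,0,y)\ge0\}$ is open. Then $d$ has extensions to cocycles on $G_n$. Furthermore, there is an extension of $d$ to a cocycle on $G_n$ so that the corresponding analytic subalgebra of $O_n$ is $A(Q_+)$, where $$Q_+=\{(x,k,y)\in G_n\mid \text{either } k=0\text{ and }(x,0,y)\in Q,\ \text{or } k>0\}.$$
   Context: Fix a finite $n\ge 2$. $X=\prod_{1}^{\infty}\{1,\dots,n\}$ with the product topology. For a (possibly empty) finite string $\alpha$ in $\{1,\dots,n\}$, $\ell(\alpha)$ is its length, and $\alpha\gamma$ ($\gamma\in X$) is the concatenation. The Cuntz groupoid is $G_n=\{(\alpha\gamma,\ell(\alpha)-\ell(\beta),\beta\gamma)\mid \alpha,\beta \text{ finite strings},\ \gamma\in X\}$ with $(x,k,y)(y,j,z)=(x,k+j,z)$, $(x,k,y)^{-1}=(y,-k,x)$, and topology with basis the (compact open) sets $U_{\alpha,\beta}=\{(\alpha\gamma,\ell(\alpha)-\ell(\beta),\beta\gamma)\mid\gamma\in X\}$. The groupoid C*-algebra $C^*(G_n)$ is the completion of $C_c(G_n)$ (with convolution $f*g(x,k,y)=\sum f(x,k_1,z)g(z,k_2,y)$, the sum over $k_1+k_2=k$ and $z$ with both factors in $G_n$, and $f^*(x,k,y)=\overline{f(y,-k,x)}$) in the groupoid C*-norm. The Cuntz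 algebra $O_n$ is identified with $C^*(G_n)$, the element $S_\alpha S_\beta^*$ corresponding to the characteristic function of $U_{\alpha,\beta}$. Since the sup norm is dominated by the C*-norm, elements of $C^*(G_n)$ are viewed as continuous functions on $G_n$ vanishing at infinity. For an open $P\subseteq G_n$, $A(P)=\{f\in C^*(G_n)\mid f \text{ vanishes on } G_n\setminus P\}$. $P_{UHF}=\{(x,k,y)\in G_n\mid k=0\}$; $A(P_{UHF})$ is the canonical UHF subalgebra of $O_n$. A cocycle on $G_n$ is a continuous function $d:G_n\to\mathbb{R}$ with $d(x,k,y)+d(y,l,z)=d(x,k+l,z)$ for all $(x,k,y),(y,l,z)\in G_n$; a cocycle on $P_{UHF}$ is defined likewise, by continuity and $d(x,0,y)+d(y,0,z)=d(x,0,z)$. If $P=\{d\ge0\}$ is open, $A(P)$ is called the analytic subalgebra associated with (corresponding to) $d$. A cocycle $d$ on $P_{UHF}$ is trivial if there is a continuous $b:X\to\mathbb{R}$ such that $d(x,0,y)=b(y)-b(x)$ for all $(x,0,y)\in P_{UHF}$; an analytic subalgebra of $A(P_{UHF})$ whose cocycle is trivial is called trivially analytic. *)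

(* Defs.v *)
From HB Require Import structures.
From mathcomp Require Import all_boot all_order all_algebra.
From mathcomp Require Import all_classical all_reals all_analysis.
From mathcomp Require Import complex.
From mathcomp Require Import zify ring.

Set Implicit Arguments.
Unset Strict Implicit.
Unset Printing Implicit Defensive.

Import Order.TTheory GRing.Theory Num.Theory.
Import numFieldNormedType.Exports.

Local Open Scope classical_set_scope.
Local Open Scope ring_scope.

(* The alphabet {1, ..., n} is represented by 'I_n. *)
Definition path_space (n : nat) : Type :=
  prod_topology (fun _ : nat => discrete_topology 'I_n).

HB.instance Definition _ (n : nat) := Topological.copy (path_space n)
  (prod_topology (fun _ : nat => discrete_topology 'I_n)).

Fixpoint scat (n : nat) (a : seq 'I_n) (x : path_space n) : path_space n :=
  if a is s :: a' then fun i : nat => if i is j.+1 then scat a' x j else s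
  else x.

Lemma scat_cat (n : nat) (a b : seq 'I_n) (x : path_space n) :
  scat (a ++ b) x = scat a (scat b x).
Proof.
elim: a => //= s a IH; apply: funext => -[|j] //=.
by rewrite IH.
Qed.

Lemma scat_prefix (n : nat) (a b : seq 'I_n) (x y : path_space n) :
  (size a <= size b)%N -> scat a x = scat b y ->
  exists c, b = a ++ c /\ x = scat c y.
Proof.
elim: a b => [|s a IH] [|t b] //= ab e; first by exists [::].
  by exists (t :: b).
have e0 : s = t := congr1 (fun f : nat -> 'I_n => f 0%N) e.
have e1 : scat a x = scat b y.
  by apply: funext => j; exact: (congr1 (fun f : nat -> 'I_n => f j.+1) e).
have [c [-> ->]] := IH _ ab e1.
by exists c; rewrite e0.
Qed.

Definition cuntz_triple (n : nat) (x : path_space n) (k : int)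
    (y : path_space n) : Prop :=
  exists a b z, [/\ x = scat a z, k = (size a)%:Z - (size b)%:Z & y = scat b z].

Record cuntz_groupoid (n : nat) := CuntzElt {
  rng : path_space n;
  deg : int;
  src : path_space n;
  cuntz_eltP : cuntz_triple rng deg src }.

HB.instance Definition _ (n : nat) := gen_eqMixin (cuntz_groupoid n).
HB.instance Definition _ (n : nat) := gen_choiceMixin (cuntz_groupoid n).

Definition basic_bisection (n : nat) (a b : seq 'I_n) :
    set (cuntz_groupoid n) :=
  [set g | exists z, [/\ rng g = scat a z, deg g = (size a)%:Z - (size b)%:Z
                       & src g = scat b z]].

Definition basic_bisections (n : nat) : set (set (cuntz_groupoid n)) :=
  [set U | exists a b, U = basic_bisection a b].

Lemma basic_bisections_cover (n : nat) :
  \bigcup_(U in @basic_bisections n) U = setT.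
Proof.
rewrite -subTset => g _; have [a [b [z zP]]] := cuntz_eltP g.
by exists (basic_bisection a b); [exists a, b|exists z].
Qed.

Lemma basic_bisection_sub (n : nat) (a b a' b' : seq 'I_n)
    (g : cuntz_groupoid n) :
  (size a <= size a')%N -> basic_bisection a b g -> basic_bisection a' b' g ->
  basic_bisection a' b' `<=` basic_bisection a b.
Proof.
move=> aa' [z [zr zd zs]] [w [wr wd ws]].
have dE : (size a)%:Z + (size b')%:Z = (size a')%:Z + (size b)%:Z.
  by move: zd; rewrite wd; lia.
have bb' : (size b <= size b')%N by lia.
have [c [ca cz]] := scat_prefix aa' (etrans (esym zr) wr).
have [c' [cb cz']] := scat_prefix bb' (etrans (esym zs) ws).
have cc' : c = c'.
  have : scat c w = scat c' w by rewrite -cz.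
  have szc : size c = size c'.
    by move: dE; rewrite ca cb !size_cat; lia.
  move=> /(scat_prefix (eq_leq szc)) [e [ec _]].
  have := congr1 size ec; rewrite size_cat szc => /eqP.
  rewrite -[X in X == _]addn0 eqn_add2l eq_sym => /nilP e0.
  by rewrite ec e0 cats0.
move=> h [y [yr yd ys]]; exists (scat c y); split.
- by rewrite -scat_cat -ca.
- by rewrite yd -wd.
- by rewrite cc' -scat_cat -cb.
Qed.

Lemma basic_bisections_join (n : nat) (U V : set (cuntz_groupoid n)) g :
  basic_bisections U -> basic_bisections V -> U g -> V g ->
  exists W, [/\ basic_bisections W, W g & W `<=` U `&` V].
Proof.
move=> [a [b ->]] [a' [b' ->]] Ug Vg.
case: (leqP (size a) (size a')) => [aa'|/ltnW aa'].
  exists (basic_bisection a' b'); split=> //; first by exists a', b'.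
  by move=> h hV; split=> //; exact: (basic_bisection_sub aa' Ug Vg).
exists (basic_bisection a b); split=> //; first by exists a, b.
by move=> h hU; split=> //; exact: (basic_bisection_sub aa' Vg Ug).
Qed.

HB.instance Definition _ (n : nat) := isBaseTopological.Build
  (cuntz_groupoid n) (@basic_bisections_cover n) (@basic_bisections_join n).

Lemma cuntz_triple_mul (n : nat) (x y z : path_space n) (k l : int) :
  cuntz_triple x k y -> cuntz_triple y l z -> cuntz_triple x (k + l) z.
Proof.
move=> [a [b [u [-> -> ->]]]] [b' [c [v [e -> ->]]]].
case: (leqP (size b) (size b')) => [bb'|/ltnW bb'].
  have [w [-> ->]] := scat_prefix bb' e.
  exists (a ++ w), c, v; split=> //; first by rewrite scat_cat.
  by rewrite !size_cat !PoszD; ring.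
have [w [-> ->]] := scat_prefix bb' (esym e).
exists a, (c ++ w), u; split=> //; last by rewrite scat_cat.
by rewrite !size_cat !PoszD; ring.
Qed.

Lemma cuntz_triple_inv (n : nat) (x y : path_space n) (k : int) :
  cuntz_triple x k y -> cuntz_triple y (- k) x.
Proof.
by move=> [a [b [u [-> -> ->]]]]; exists b, a, u; split=> //; rewrite opprB.
Qed.

Definition gmul (n : nat) (g h : cuntz_groupoid n) (e : src g = rng h) :
    cuntz_groupoid n :=
  CuntzElt (cuntz_triple_mul (cuntz_eltP g)
    (eq_ind_r (fun y => cuntz_triple y (deg h) (src h)) (cuntz_eltP h) e)).

Definition ginv (n : nat) (g : cuntz_groupoid n) : cuntz_groupoid n :=
  CuntzElt (cuntz_triple_inv (cuntz_eltP g)).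

#[non_forgetful_inheritance]
HB.instance Definition _ (R : realType) :=
  PseudoPointedMetric.copy R[i] (R[i] : numClosedFieldType)^o.

Section convolution_algebra.
Variables (R : realType) (n : nat).
Local Notation G := (cuntz_groupoid n).
Local Notation C := R[i].

Definition Cc : set (G -> C) :=
  [set f | continuous f /\ compact (closure [set g | f g != 0])].

(* The sum has finitely many nonzero terms when f and h are in Cc. *)
Definition conv (f h : G -> C) : G -> C := fun g =>
  \sum_(p \in [set p : G * G | exists e : src p.1 = rng p.2, gmul e = g])
    f p.1 * h p.2.

Definition star (f : G -> C) : G -> C := fun g => (f (ginv g))^*%R.

End convolution_algebra.

Section groupoid_cstar_norm.
Variables (R : realType) (n : nat).
Local Notation G := (cuntz_groupoid n).
Local Notation C := R[i].

Definition hnorm (H : lmodType C) (ip : {dot H for Num.conj}) (xi : H) : R :=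
  Num.sqrt (complex.Re (ip xi xi)).

Definition hilbert_complete (H : lmodType C) (ip : {dot H for Num.conj}) :=
  forall u : nat -> H,
    (forall e : R, 0 < e -> exists N : nat, forall i j : nat,
       (N <= i)%N -> (N <= j)%N -> hnorm ip (u i - u j) < e) ->
    exists l : H, forall e : R, 0 < e -> exists N : nat, forall i : nat,
       (N <= i)%N -> hnorm ip (u i - l) < e.

(* *-representations of Cc by bounded operators on the Hilbert space (H, ip);
   the values of pi outside Cc are irrelevant. *)
Record star_representation (H : lmodType C) (ip : {dot H for Num.conj})
    (pi : (G -> C) -> H -> H) : Prop := {
  rep_op_linear : forall f, Cc f -> linear (pi f);
  rep_op_bounded : forall f, Cc f ->
    exists M : R, forall xi, hnorm ip (pi f xi) <= M * hnorm ip xi;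
  rep_linear : forall (c : C) f h xi, Cc f -> Cc h ->
    pi (fun g => c * f g + h g) xi = c *: pi f xi + pi h xi;
  rep_conv : forall f h xi, Cc f -> Cc h ->
    pi (conv f h) xi = pi f (pi h xi);
  rep_star : forall f xi eta, Cc f ->
    ip (pi f xi) eta = ip xi (pi (star f) eta) }.

(* The supremum of the operator norms of f under all *-representations. Since
   the groupoid is étale, every *-representation is bounded by the I-norm, so
   no boundedness hypothesis is imposed and the supremum is finite on Cc. *)
Definition cstar_norm (f : G -> C) : \bar R :=
  ereal_sup [set r : \bar R | exists (H : lmodType C)
    (ip : {dot H for Num.conj}) (pi : (G -> C) -> H -> H) (xi : H),
    [/\ hilbert_complete ip, star_representation ip pi, hnorm ip xi <= 1
      & r = (hnorm ip (pi f xi))%:E]].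

(* C*(G_n), realised as functions on G_n: the sup norm is dominated by the
   C*-norm, so a C*-norm Cauchy sequence in Cc, which represents a point of the
   completion, has a uniform limit, the function viewed as that point. *)
Definition cuntz_algebra : set (G -> C) :=
  [set f | exists u : nat -> G -> C,
    [/\ forall i, Cc (u i),
        forall e : R, 0 < e -> exists N : nat, forall i j : nat,
          (N <= i)%N -> (N <= j)%N -> (cstar_norm (fun g => (u i g - u j g)%R) < e%:E)%E
      & {uniform, u @ \oo --> f}]].

Definition subspace_of (P : set G) : set (G -> C) :=
  [set f | cuntz_algebra f /\ forall g, ~ P g -> f g = 0].

End groupoid_cstar_norm.

Section cocycles.
Variables (R : realType) (n : nat).
Local Notation G := (cuntz_groupoid n).

Definition P_UHF : set G := [set g | deg g = 0].

Definition cocycle (d : G -> R) : Prop :=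
  continuous d /\
  forall (g h : G) (e : src g = rng h), d (gmul e) = d g + d h.

(* A cocycle on P_UHF is represented by a function on the whole groupoid of
   which only the restriction to P_UHF matters. *)
Definition uhf_cocycle (d : G -> R) : Prop :=
  {within P_UHF, continuous d} /\
  forall (g h : G) (e : src g = rng h), P_UHF g -> P_UHF h ->
    d (gmul e) = d g + d h.

Definition trivial_uhf_cocycle (d : G -> R) : Prop :=
  exists b : path_space n -> R, continuous b /\
    forall g, P_UHF g -> d g = b (src g) - b (rng g).

Definition uhf_nonneg (d : G -> R) : set G := [set g | P_UHF g /\ 0 <= d g].

Definition extends_uhf (c d : G -> R) : Prop :=
  forall g, P_UHF g -> c g = d g.

Definition is_analytic_subalgebra (c : G -> R) (B : set (G -> R[i])) : Prop :=
  [/\ cocycle c, open [set g | 0 <= c g]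
    & B = @subspace_of R n [set g | 0 <= c g]].

Definition Q_plus (Q : set G) : set G :=
  [set g | (deg g = 0 /\ Q g) \/ 0 < deg g].

End cocycles.

(* Main.v *)
Require Import Defs.
From mathcomp Require Import all_boot all_order all_algebra.
From mathcomp Require Import all_classical all_reals all_analysis.
From mathcomp Require Import complex.
From mathcomp Require Import ring lra zify.
Import Order.TTheory GRing.Theory Num.Theory.
Import numFieldNormedType.Exports.
Local Open Scope classical_set_scope.
Local Open Scope ring_scope.

(** A trivial cocycle d(x,0,y) = b(y) - b(x) is extended by adding a multiple
of the degree: for every real M,
    c_M(x,k,y) = b(y) - b(x) + M k
is a cocycle on the whole groupoid, because the degree is additive on products
and source, range and degree are continuous ([coboundary_twist_cocycle]).
It restricts to d on the elements of degree 0.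

The path space is compact by Tychonoff, so |b| < B for some B
([continuous_path_bounded]), hence |b(y) - b(x)| < 2B everywhere. With M = 2B
the sign of c_M is the sign of the degree as soon as the degree is nonzero
([coboundary_twist_ge0]). Thus {c_M >= 0} consists of Q in degree 0 and of all
elements of positive degree, which is Q_+ as a set; it is open since Q is open
and the degree is locally constant. The two subalgebras then coincide because
they are defined from the same subset of the groupoid. *)

Definition coboundary_twist {R : realType} {n : nat} (b : path_space n -> R)
    (M : R) (g : cuntz_groupoid n) : R :=
  b (src g) - b (rng g) + M * (deg g)%:~R.

Section groupoid_topology.
Context {n : nat}.
Implicit Types (g : cuntz_groupoid n) (a b : seq 'I_n) (x : path_space n).

Lemma basic_bisection_nbhs a b g :
  basic_bisection a b g -> nbhs g (basic_bisection a b).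
Proof.
move=> gU; apply: open_nbhs_nbhs; split=> //.
exists [set basic_bisection a b]; last by rewrite bigcup_set1.
by move=> _ ->; exists a, b.
Qed.

Lemma scat_take_drop x k :
  scat (mkseq x k) (fun i => x (k + i)%N) = x.
Proof.
elim: k x => [//|k IH] x; apply: funext => -[//|i] /=.
rewrite -[1%N]addn0 iotaDl -map_comp.
exact: (congr1 (fun f : nat -> 'I_n => f i) (IH (fun j => x j.+1))).
Qed.

Lemma scat_nth a x y i : (i < size a)%N -> scat a x i = scat a y i.
Proof. by elim: a i => [//|s a IH] [//|i] /= /IH. Qed.

(** Lengthening both strings by a prefix of the common tail gives arbitrarily
small basic neighborhoods; on such a neighborhood the first k letters of both
endpoints are fixed. *)
Lemma basic_bisection_long g k :
  exists a b, [/\ (k <= size a)%N, (k <= size b)%N & basic_bisection a b g].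
Proof.
have [a [b [z [rE dE sE]]]] := cuntz_eltP g.
exists (a ++ mkseq z k), (b ++ mkseq z k).
rewrite !size_cat !size_mkseq; split; [exact: leq_addl|exact: leq_addl|].
exists (fun i => z (k + i)%N); rewrite !scat_cat scat_take_drop.
by split=> //; rewrite dE !size_cat !size_mkseq; lia.
Qed.

Lemma deg_locally_constant g : \forall h \near g, deg h = deg g.
Proof.
have [a [b [_ _ gU]]] := basic_bisection_long g 0.
apply: filterS (basic_bisection_nbhs a b g gU) => h [_ [_ -> _]].
by case: gU => z [_ -> _].
Qed.

Lemma open_deg (P : int -> Prop) : open [set g : cuntz_groupoid n | P (deg g)].
Proof.
rewrite openE => g Pg; apply: filterS (deg_locally_constant g) => h /= hE.
by rewrite hE.
Qed.

(** Continuity into a product is coordinatewise, and each factor is discrete. *)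
Lemma continuous_to_path_space (T : topologicalType) (f : T -> path_space n) :
  (forall t i, \forall s \near t, f s i = f t i) -> continuous f.
Proof.
move=> fnear t; apply/cvg_sup => i U [V [[W oW <-] WfN WU]].
apply: filterS (fnear t i) => s /= fsi; apply: WU.
by rewrite /= fsi.
Qed.

Lemma continuous_rng : continuous (@rng n).
Proof.
apply: continuous_to_path_space => g i.
have [a [b [ia _ gU]]] := basic_bisection_long g i.+1.
apply: filterS (basic_bisection_nbhs a b g gU) => h [w [-> _ _]].
by case: gU => z [-> _ _]; exact: scat_nth.
Qed.

Lemma continuous_src : continuous (@src n).
Proof.
apply: continuous_to_path_space => g i.
have [a [b [_ ib gU]]] := basic_bisection_long g i.+1.
apply: filterS (basic_bisection_nbhs a b g gU) => h [w [_ _ ->]].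
by case: gU => z [_ _ ->]; exact: scat_nth.
Qed.

Lemma path_space_compact : compact [set: path_space n].
Proof.
have /finite_compact fin : finite_set [set: discrete_topology 'I_n].
  exact: (@finite_finset 'I_n).
have := tychonoff (fun _ : nat => fin).
set A := (X in compact X -> _).
suff -> : A = [set: path_space n] by [].
by rewrite eqEsubset.
Qed.

Context {R : realType}.
Variable b : path_space n -> R.
Hypothesis b_cont : continuous b.

Lemma continuous_path_bounded : exists B : R, forall x, `|b x| < B.
Proof.
have /compact_bounded [B [_ Bb]] : compact (b @` [set: path_space n]).
  by apply: continuous_compact path_space_compact; apply: continuous_subspaceT.
exists (B + 2) => x; apply: (@le_lt_trans _ _ (B + 1)); last by lra.
by apply: Bb; [lra|exists x].
Qed.

Lemma coboundary_twist_cocycle (M : R) : cocycle (coboundary_twist b M).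
Proof.
split=> [g|g h e]; last first.
  by rewrite /coboundary_twist /= rmorphD /= e; ring.
have cv_src : (b \o @src n) @ g --> b (src g).
  exact: (continuous_comp (continuous_src g) (b_cont _)).
have cv_rng : (b \o @rng n) @ g --> b (rng g).
  exact: (continuous_comp (continuous_rng g) (b_cont _)).
apply: (cvgD (cvgB cv_src cv_rng)).
by apply: cvg_near_cst; apply: filterS (deg_locally_constant g) => h ->.
Qed.

(** A slope of twice a strict bound of b beats every value of the coboundary as
soon as the degree is a nonzero integer. *)
Lemma coboundary_twist_ge0 (B : R) g : (forall x, `|b x| < B) ->
  (0 <= coboundary_twist b (2 * B) g) =
  (deg g == 0) && (0 <= b (src g) - b (rng g)) || (0 < deg g).
Proof.
move=> bB; rewrite /coboundary_twist.
move: (bB (src g)) (bB (rng g)); rewrite !ltr_norml => /andP[s1 s2] /andP[r1 r2].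
have [kneg|kpos|->] := ltgtP (deg g) 0; last by rewrite mulr0 addr0 orbF.
  have : (deg g)%:~R <= -1 :> R by rewrite -[-1]/((-1)%:~R) ler_int; lia.
  by move=> ?; apply/negbTE; rewrite -ltNge; nra.
have : 1 <= (deg g)%:~R :> R by rewrite -[1]/(1%:~R) ler_int; lia.
by move=> ? /=; nra.
Qed.

End groupoid_topology.

Theorem theorem5 (R : realType) (n : nat) (d : cuntz_groupoid n -> R)
    (n_ge2 : (2 <= n)%N)
    (d_cocycle : uhf_cocycle d)
    (d_trivial : trivial_uhf_cocycle d)
    (d_neq0 : exists g, @P_UHF n g /\ d g <> 0)
    (Q_open : open (uhf_nonneg d)) :
  (exists c : cuntz_groupoid n -> R, cocycle c /\ extends_uhf c d) /\
  (exists c : cuntz_groupoid n -> R,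
     extends_uhf c d /\
     is_analytic_subalgebra c (@subspace_of R n (Q_plus (uhf_nonneg d)))).
Proof.
have [b [b_cont dE]] := d_trivial.
have [B bB] := continuous_path_bounded b b_cont.
pose c := coboundary_twist b (2 * B).
have c_cocycle : cocycle c by exact: coboundary_twist_cocycle.
have c_ext : extends_uhf c d.
  by move=> g g0; rewrite dE// /c /coboundary_twist g0 mulr0 addr0.
have nonnegE : [set g | 0 <= c g] = Q_plus (uhf_nonneg d).
  apply/seteqP; split=> g /=; rewrite coboundary_twist_ge0//.
    case/orP=> [/andP[/eqP g0 ?]|]; last by right.
    by left; split=> //; split=> //; rewrite dE.
  case=> [[g0 [_]]|->]; last by rewrite orbT.
  by rewrite dE// => ->; rewrite g0 eqxx.
split; exists c; split=> //; split=> //; last by rewrite nonnegE.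
have -> : [set g | 0 <= c g] = uhf_nonneg d `|` [set g | 0 < deg g].
  rewrite nonnegE; apply/seteqP; split=> g; first by case=> [[_]|]; [left|right].
  by case=> [Qg|]; [left; split=> //; case: Qg|right].
by apply: openU => //; exact: (open_deg (fun k => 0 < k)).
Qed.
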